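(* Let $n\ge1$, let $A$ be a symmetric real $n\times n$ matrix with $A\le 0$, and let $L(x,v)=\frac12|v|^2-\frac12\,x\cdot Ax$ on $T\mathbb{R}^n$. For $T>0$ let $$c(x,y)=c_T(x,y)=\inf\int_0^TL(\gamma(t),\dot\gamma(t))\,dt,$$ the infimum being over all smooth curves $\gamma:[0,T]\to\mathbb{R}^n$ with $\gamma(0)=x$ and $\gamma(T)=y$. Then $c$ satisfies conditions (A0), (A1) and (A2) on $\mathbb{R}^n\times\mathbb{R}^n$, and the cross-curvature of $c$ is identically zero. In particular, $c$ is non-negatively cross-curved (condition (B3w)), a fortiori satisfies the weak Ma-Trudinger-Wang condition (A3w), on $\mathbb{R}^n\times\mathbb{R}^n$.
   Context: For a cost $c$ on $\mathbb{R}^n\times\mathbb{R}^n$ the conditions are: (A0) $c$ is $C^4$ on $\mathbb{R}^n\times\mathbb{R}^n$; (A1) for each $x$ the map $y\mapsto d_xc(x,y)$ is injective on $\mathbb{R}^n$; (A2) for each $(x,y)$ the linear map $v\mapsto d_xd_yc(x,y)(v)$ from $T_y\mathbb{R}^n$ to $T_x^*\mathbb{R}^n$ is injective. Let $\mathcal K_x=\{-d_xc(x,y):y\in\mathbb{R}^n\}\subset T^*_x\mathbb{R}^n$ and, for $\alpha\in\mathcal K_x$, let $\exp^c(x,\alpha)$ be the point $y\in\mathbb{R}^n$ with $d_xc(x,y)=-\alpha$. The cross-curvature is $$\mathcal C_x(u,\alpha,\alpha_1)=-\frac32\,\partial_s^2\partial_t^2\,c\big(\gamma(t),\exp^c(x,\alpha+s\alpha_1)\big)\Big|_{t=s=0},\quad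 u\in T_x\mathbb{R}^n,\ \alpha\in\mathcal K_x,\ \alpha_1\in T_x^*\mathbb{R}^n,$$ where $\gamma$ is any curve with $\gamma(0)=x$, $\dot\gamma(0)=u$. Condition (B3w): $\mathcal C\ge0$ everywhere. Condition (A3w): $\mathcal C_x(u,\alpha,\alpha_1)\ge0$ whenever $\alpha_1(u)=0$. *)

(* Defs.v *)
From HB Require Import structures.
From mathcomp Require Import all_boot all_order all_algebra.
From mathcomp Require Import all_classical all_reals all_analysis.

Set Implicit Arguments.
Unset Strict Implicit.
Unset Printing Implicit Defensive.

Import Order.TTheory GRing.Theory Num.Theory.
Import numFieldNormedType.Exports.

Local Open Scope classical_set_scope.
Local Open Scope ring_scope.

(** Points and tangent vectors of R^n are column vectors.  The norm that the
    library puts on matrices is the sup norm (used here for the topology only);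
    Euclidean quantities are written with [dot]. *)
Definition dot (R : realType) (n : nat) (u v : 'cV[R]_n) : R :=
  (u^T *m v) 0 0.

Definition negsemidef (R : realType) (n : nat) (A : 'M[R]_n) : Prop :=
  forall v : 'cV[R]_n, dot v (A *m v) <= 0.

(** [Ck_on k U f]: f is of class C^k on the open set U; f is differentiable and
    x |-> df_x is C^(k-1), the latter being tested on each vector v, which is
    enough because the spaces below are finite dimensional. *)
Fixpoint Ck_on (R : realType) (V W : normedModType R) (k : nat) (U : set V)
    (f : V -> W) : Prop :=
  if k is j.+1 then
    (forall x, U x -> differentiable f x) /\
    (forall v : V, Ck_on j U (fun x => 'D_v f x))
  else forall x, U x -> {for x, continuous f}.

(** C^k in a neighbourhood of a set S that need not be open. *)
Definition Ck_near (R : realType) (V W : normedModType R) (k : nat) (S : set V)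
    (f : V -> W) : Prop :=
  exists U : set V, [/\ open U, S `<=` U & Ck_on k U f].

(** Smoothness on a set that need not be open means having a smooth extension
    to an open neighbourhood; the values of f : V -> W away from S are
    irrelevant, so f stands for an extension of a map defined on S. *)
Definition smooth_near (R : realType) (V W : normedModType R) (S : set V)
    (f : V -> W) : Prop :=
  exists U : set V, [/\ open U, S `<=` U & forall k : nat, Ck_on k U f].

Section LagrangianCost.
Variables (R : realType) (n : nat) (A : 'M[R]_n).

Definition lagrangian (x v : 'cV[R]_n) : R :=
  2^-1 * dot v v - 2^-1 * dot x (A *m x).

Definition action (T : R) (g : R -> 'cV[R]_n) : R :=
  \int[lebesgue_measure]_(t in `[0, T]) lagrangian (g t) (derive1 g t).

Definition admissible (T : R) (x y : 'cV[R]_n) : set (R -> 'cV[R]_n) :=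
  [set g | [/\ smooth_near `[0, T] g, g 0 = x & g T = y]].

(** When A <= 0 the actions are bounded below by 0, so that this infimum is the
    genuine one and not the default value of [inf]. *)
Definition lagrangian_cost (T : R) (x y : 'cV[R]_n) : R :=
  inf [set action T g | g in admissible T x y].

End LagrangianCost.

Section CostConditions.
Variables (R : realType) (n : nat).

(** Both cotangent spaces T*_x R^n and T*_y R^n. *)
Definition covector := 'Hom('cV[R]_n, R).

Variable c : 'cV[R]_n -> 'cV[R]_n -> R.

Definition dx (x y : 'cV[R]_n) : covector := linfun ('d (fun x' => c x' y) x).

(** The covector d_x d_y c(x, y)(v), given as a function of the tangent vector u
    at x (it is linear in u as soon as c is C^2). *)
Definition dxdy (x y v : 'cV[R]_n) : 'cV[R]_n -> R :=
  fun u => 'D_v (fun y' => dx x y' u) y.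

Definition condA0 : Prop :=
  Ck_on 4 setT (fun p : 'cV[R]_n * 'cV[R]_n => c p.1 p.2).

Definition condA1 : Prop := forall x, injective (dx x).

Definition condA2 : Prop := forall x y, injective (dxdy x y).

Definition Kdom (x : 'cV[R]_n) : set covector := range (fun y => - dx x y).

(** Meaningful for a in [Kdom x]; the point is unique under [condA1]. *)
Definition cexp (x : 'cV[R]_n) (a : covector) : 'cV[R]_n :=
  get [set y | dx x y = - a].

Definition curve_through (x u : 'cV[R]_n) (g : R -> 'cV[R]_n) : Prop :=
  [/\ Ck_near 2 [set 0] g, g 0 = x & derive1 g 0 = u].

(** C_x(u, a, a1) computed along the curve g, where [curve_through x u g]. *)
Definition cross_curvature (x : 'cV[R]_n) (g : R -> 'cV[R]_n)
    (a a1 : covector) : R :=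
  - (3 / 2) *
  derive1n 2 (fun s => derive1n 2 (fun t => c (g t) (cexp x (a + s *: a1))) 0) 0.

(** The value of the cross-curvature does not depend on the curve representing
    the tangent vector; the conditions below quantify over all of them. *)
Definition cross_curvature_zero : Prop :=
  forall (x u : 'cV[R]_n) (a a1 : covector) (g : R -> 'cV[R]_n),
    Kdom x a -> curve_through x u g -> cross_curvature x g a a1 = 0.

Definition condB3w : Prop :=
  forall (x u : 'cV[R]_n) (a a1 : covector) (g : R -> 'cV[R]_n),
    Kdom x a -> curve_through x u g -> 0 <= cross_curvature x g a a1.

Definition condA3w : Prop :=
  forall (x u : 'cV[R]_n) (a a1 : covector) (g : R -> 'cV[R]_n),
    Kdom x a -> curve_through x u g -> a1 u = 0 ->
    0 <= cross_curvature x g a a1.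

End CostConditions.

(* Main.v *)
Require Import Defs.
From HB Require Import structures.
From mathcomp Require Import all_boot all_order all_algebra.
From mathcomp Require Import all_classical all_reals all_analysis.
From mathcomp Require Import ring lra.

Import Order.TTheory GRing.Theory Num.Theory.
Import numFieldNormedType.Exports.
Local Open Scope ring_scope.
Local Open Scope classical_set_scope.

(** The Euler-Lagrange equation h'' = - A h is linear, and its solutions are
    h = C z + S w, where C and S are the cosh- and sinh-type power series in - A.
    Since A <= 0, S(T) is invertible, so any two points are joined by a unique
    extremal, and convexity of L makes it minimizing: c = (h(T).h'(T) -
    h(0).h'(0))/2. This is a quadratic function of (x, y), and constancy of the
    Wronskian identifies its mixed part as - x.S(T)^-1 y, which is nondegenerate.
    Finally, dx c(x, y) is affine in y, so that y = exp^c(x, a + s a1) is affine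
    in s and c(g(t), y) is the sum of a term affine in s and of one that does not
    depend on t; hence d_s^2 d_t^2 kills it. *)

(** * The Euclidean inner product on column vectors *)

Section Dot.
Context {R : realType} {n : nat}.
Implicit Types (u v w : 'cV[R]_n) (M : 'M[R]_n).

Lemma dotE u v : dot u v = \sum_i u i 0 * v i 0.
Proof. by rewrite /dot mxE; apply: eq_bigr => i _; rewrite mxE. Qed.

Lemma dotC u v : dot u v = dot v u.
Proof. by rewrite !dotE; apply: eq_bigr => i _; rewrite mulrC. Qed.

Lemma dotDl u v w : dot (u + v) w = dot u w + dot v w.
Proof. by rewrite /dot linearD /= mulmxDl mxE. Qed.

Lemma dotZl (a : R) u w : dot (a *: u) w = a * dot u w.
Proof. by rewrite /dot linearZ /= -scalemxAl mxE. Qed.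

Lemma dotNl u w : dot (- u) w = - dot u w.
Proof. by rewrite -scaleN1r dotZl mulN1r. Qed.

Lemma dot0l w : dot 0 w = 0.
Proof. by rewrite -(scale0r 0) dotZl mul0r. Qed.

Lemma dotDr u v w : dot w (u + v) = dot w u + dot w v.
Proof. by rewrite dotC dotDl !(dotC w). Qed.

Lemma dotZr (a : R) u w : dot w (a *: u) = a * dot w u.
Proof. by rewrite dotC dotZl (dotC w). Qed.

Lemma dotNr u w : dot w (- u) = - dot w u.
Proof. by rewrite dotC dotNl (dotC w). Qed.

Lemma dot0r w : dot w 0 = 0.
Proof. by rewrite dotC dot0l. Qed.

Lemma dot_mulmxr u v M : dot u (M *m v) = dot (M^T *m u) v.
Proof. by rewrite /dot trmx_mul trmxK mulmxA. Qed.

Lemma dotvv_ge0 u : 0 <= dot u u.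
Proof. by rewrite dotE sumr_ge0 // => i _; rewrite -expr2 sqr_ge0. Qed.

Lemma dotvv_eq0 u : dot u u = 0 -> u = 0.
Proof.
move=> /eqP; rewrite dotE psumr_eq0 => [/allP u0|i _]; last first.
  by rewrite -expr2 sqr_ge0.
apply/matrixP => i j; rewrite ord1 mxE.
by have := u0 i (mem_index_enum _); rewrite /= -expr2 sqrf_eq0 => /eqP.
Qed.

Lemma dotl_inj u v : (forall w, dot w u = dot w v) -> u = v.
Proof.
move=> uv; apply/eqP; rewrite -subr_eq0; apply/eqP/dotvv_eq0.
by rewrite dotDr dotNr uv subrr.
Qed.

End Dot.

(** * Differentiation of matrix-valued functions *)

Section MatrixDerivative.
Context {R : realType} {V : normedModType R}.

Lemma is_derive_mxP {m n} (M : V -> 'M[R]_(m, n)) (dM : 'M[R]_(m, n)) t v :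
  is_derive t v M dM <->
  forall i j, is_derive t v (fun x => M x i j) (dM i j).
Proof.
split=> [dMt i j|dMt].
  have Mt : derivable M t v by exact: ex_derive.
  apply: DeriveDef; first by move/derivable_mxP : Mt.
  by rewrite -(@derive_val _ _ _ _ _ _ _ dMt) derive_mx// mxE.
have Mt : derivable M t v by apply/derivable_mxP => i j; exact: ex_derive.
apply: DeriveDef => //; rewrite derive_mx//.
by apply/matrixP => i j; rewrite mxE derive_val.
Qed.

Lemma is_derive_bigsum (I : Type) (r : seq I) (f : I -> V -> R) (df : I -> R)
    t v :
  (forall i, is_derive t v (f i) (df i)) ->
  is_derive t v (fun x => \sum_(i <- r) f i x) (\sum_(i <- r) df i).
Proof.
move=> fdf; elim: r => [|i r IH].
  rewrite big_nil (_ : (fun _ => _) = cst 0); first exact: is_derive_cst.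
  by apply/funext => x; rewrite big_nil.
rewrite big_cons (_ : (fun _ => _) = f i + (fun x => \sum_(i <- r) f i x)).
  exact: is_deriveD.
by apply/funext => x; rewrite big_cons.
Qed.

Lemma is_derive_mulmxr {m n p} (A : 'M[R]_(m, n)) {M : V -> 'M[R]_(n, p)} {dM}
    {t v} :
  is_derive t v M dM -> is_derive t v (fun x => A *m M x) (A *m dM).
Proof.
move=> /is_derive_mxP dMt; apply/is_derive_mxP => i j.
rewrite mxE (_ : (fun _ => _) = fun x => \sum_k A i k * M x k j); last first.
  by apply/funext => x; rewrite mxE.
by apply: is_derive_bigsum => k; exact: is_deriveZ.
Qed.

Lemma is_derive_mulmxl {m n p} (A : 'M[R]_(n, p)) {M : V -> 'M[R]_(m, n)} {dM}
    {t v} :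
  is_derive t v M dM -> is_derive t v (fun x => M x *m A) (dM *m A).
Proof.
move=> /is_derive_mxP dMt; apply/is_derive_mxP => i j.
rewrite mxE (_ : (fun _ => _) = fun x => \sum_k M x i k * A k j); last first.
  by apply/funext => x; rewrite mxE.
apply: is_derive_bigsum => k; rewrite mulrC.
rewrite (_ : (fun _ => _) = A k j *: (fun x => M x i k)); first exact: is_deriveZ.
by apply/funext => x /=; rewrite mulrC.
Qed.

Lemma is_derive_dot {n} {g h : V -> 'cV[R]_n} {dg dh t v} :
  is_derive t v g dg -> is_derive t v h dh ->
  is_derive t v (fun x => dot (g x) (h x)) (dot dg (h t) + dot (g t) dh).
Proof.
move=> /is_derive_mxP dgt /is_derive_mxP dht.
rewrite (_ : (fun _ => _) = fun x => \sum_i g x i 0 * h x i 0); last first.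
  by apply/funext => x; rewrite dotE.
rewrite !dotE -big_split/=; apply: is_derive_bigsum => i.
by apply: is_derive_eq; rewrite addrC mulrC; congr (_ + _); rewrite mulrC.
Qed.

End MatrixDerivative.

(** * Exponential power series with geometrically bounded coefficients *)

Section ExponentialSeries.
Context {R : realType}.
Implicit Types (a : nat -> R) (M K t : R).

Definition exp_series a t := pseries (fun m => a m / m`!%:R) t.
(** The exponential generating function of [a]: with the factorials built in, differentiation
    becomes the shift of [a]. *)
Definition egf a t : R := limn (exp_series a t).

(** This growth condition forces convergence on the whole line and survives the shift, hence
    repeated differentiation. *)
Definition geometrically_bounded a :=
  exists M K, 0 <= K /\ forall m, `|a m| <= M * K ^+ m.

Lemma geometrically_bounded_shift {a} :
  geometrically_bounded a -> geometrically_bounded (fun m => a m.+1).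
Proof.
move=> [M [K [K0 aMK]]]; exists (M * K), K; split=> // m.
by rewrite -mulrA -exprS.
Qed.

(** Termwise comparison with the series of M exp(K |t|). *)
Lemma is_cvg_exp_series {a} t :
  geometrically_bounded a -> cvgn (exp_series a t).
Proof.
move=> [M [K [K0 aMK]]].
have M0 : 0 <= M by have := aMK 0; rewrite expr0 mulr1; exact: le_trans.
apply: normed_cvg; rewrite /normed_series_of/=.
apply: (@series_le_cvg _ _ (M *: exp_coeff (K * `|t|))).
- by move=> m; exact: normr_ge0.
- move=> m; rewrite /= /exp_coeff /=.
  by rewrite mulr_ge0// divr_ge0// exprn_ge0// mulr_ge0.
- move=> m; rewrite /= /exp_coeff/= normrM normrX normrM normfV.
  rewrite (ger0_norm (ler0n _ _)).
  rewrite [leRHS](_ : _ = M * K ^+ m / m`!%:R * `|t| ^+ m).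
    by rewrite ler_wpM2r ?exprn_ge0// ler_wpM2r ?invr_ge0.
  transitivity (M * ((K * `|t|) ^+ m / m`!%:R)); first by [].
  by rewrite exprMn !mulrA; exact: mulrAC.
- by apply: is_cvg_seriesZ; exact: is_cvg_series_exp_coeff.
Qed.

Lemma pseries_diffs_exp a :
  pseries_diffs (fun m => a m / m`!%:R) = fun m => a m.+1 / m`!%:R.
Proof.
apply/funext => m; rewrite /pseries_diffs factS natrM invfM.
by rewrite mulrCA [X in _ * X]mulrA mulfV ?mul1r// pnatr_eq0.
Qed.

Lemma egf0 a : egf a 0 = a 0.
Proof.
apply: lim_near_cst => //; near=> m; rewrite /exp_series /pseries /series/=.
rewrite -[m]prednK; last by near: m.
rewrite big_nat_recl// big1 => [|i _]; last by rewrite expr0n mulr0.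
by rewrite expr0 fact0 divr1 mulr1 addr0.
Unshelve. all: by end_near. Qed.

Lemma is_derive_egf a t : geometrically_bounded a ->
  is_derive t 1 (egf a) (egf (fun m => a m.+1) t).
Proof.
move=> ba; have ba1 := geometrically_bounded_shift ba.
have ba2 := geometrically_bounded_shift ba1.
rewrite /egf /exp_series -pseries_diffs_exp.
(* Any radius beyond [|t|] serves, since these series converge everywhere. *)
apply: (@pseries_snd_diffs _ _ (`|t| + 1)).
- exact: is_cvg_exp_series.
- by rewrite pseries_diffs_exp; exact: is_cvg_exp_series.
- by rewrite !pseries_diffs_exp; exact: is_cvg_exp_series.
- by rewrite [ltRHS]ger0_norm ?ltrDl// addr_ge0.
Qed.

Lemma egf_lincomb {n} (b : 'I_n -> R) (a : 'I_n -> nat -> R) t :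
  (forall k, geometrically_bounded (a k)) ->
  egf (fun m => \sum_k b k * a k m) t = \sum_k b k * egf (a k) t.
Proof.
move=> ba; apply/cvg_lim => //.
rewrite (_ : exp_series _ t =
             fun N => \sum_k b k * exp_series (a k) t N); last first.
  apply/funext => N; rewrite /exp_series /pseries /series/=.
  under [RHS]eq_bigr do rewrite mulr_sumr.
  rewrite exchange_big/=; apply: eq_bigr => m _.
  by rewrite !mulr_suml; apply: eq_bigr => k _; rewrite -!mulrA.
apply: cvg_big => [|k _]; first exact: add_continuous.
by apply: cvgMl_tmp; exact: is_cvg_exp_series.
Qed.

End ExponentialSeries.

(** * Fundamental solutions of the linear system X'' = B X *)

Section FundamentalMatrices.
Context {R : realType} {n : nat} (B : 'M[R]_n).

(** Zero for even m and B^((m-1)/2) for odd m: the derivatives at 0 of the sinh-type series. Its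
    shift gives those of the cosh-type series. *)
Let D m : 'M[R]_n := iter m./2 (mulmx B) (odd m)%:R%:M.

Let DSS m : D m.+2 = B *m D m. Proof. by rewrite /D /= negbK. Qed.

Let D_bounded i j : geometrically_bounded (fun m => D m i j).
Proof.
(* [b] dominates every absolute row sum of [B]; the added 1 makes the powers of [b]
   nondecreasing. *)
pose b := \sum_i \sum_j `|B i j| + 1.
have b1 : 1 <= b.
  by rewrite lerDr sumr_ge0// => ? _; rewrite sumr_ge0.
have b0 : 0 <= b by exact: le_trans b1.
have rowb k : \sum_l `|B k l| <= b.
  rewrite /b [X in _ <= X + 1](bigD1 k)//= -addrA lerDl addr_ge0// sumr_ge0//.
  by move=> ? _; rewrite sumr_ge0.
(* The recursion [DSS] jumps by two, so two consecutive indices are carried together. *)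
suff Db m : (forall i j, `|D m i j| <= b ^+ m) /\
            (forall i j, `|D m.+1 i j| <= b ^+ m.+1).
  by exists 1, b; split => // m; rewrite mul1r; exact: (Db m).1.
elim: m => [|m [IH IH1]].
  split=> k l; rewrite /D /= !mxE ?mul0rn ?normr0 ?expr0// expr1.
  by case: (k == l); rewrite ?normr0 ?normr1.
split=> // k l; rewrite DSS mxE (le_trans (ler_norm_sum _ _ _))//.
rewrite (@le_trans _ _ (\sum_l `|B k l| * b ^+ m))//.
  by apply: ler_sum => i' _; rewrite normrM ler_wpM2l.
rewrite -mulr_suml exprS ler_pM ?sumr_ge0 ?exprn_ge0//.
by rewrite ler_weXn2l.
Qed.

(* The entrywise power series of sinh(sqrt B t)/sqrt B and cosh(sqrt B t), which
   involve only integer powers of B. *)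
Lemma cosh_sinh_mx : exists S C : R -> 'M[R]_n,
  [/\ S 0 = 0, C 0 = 1%:M,
      forall t, is_derive t (1 : R) S (C t) &
      forall t, is_derive t (1 : R) C (B *m S t)].
Proof.
exists (fun t => \matrix_(i, j) egf (fun m => D m i j) t).
exists (fun t => \matrix_(i, j) egf (fun m => D m.+1 i j) t).
split=> [||t|t].
- by apply/matrixP => i j; rewrite mxE egf0 /D/= !mxE mul0rn.
- by apply/matrixP => i j; rewrite mxE egf0 /D/= !mxE.
- apply/is_derive_mxP => i j; rewrite mxE.
  rewrite (_ : (fun _ => _) = egf (fun m => D m i j)); last first.
    by apply/funext => x; rewrite mxE.
  exact: is_derive_egf.
- apply/is_derive_mxP => i j.
  rewrite (_ : (fun _ => _) = egf (fun m => D m.+1 i j)); last first.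
    by apply/funext => x; rewrite mxE.
  rewrite (_ : (_ *m _) i j = egf (fun m => D m.+2 i j) t).
    exact/is_derive_egf/(@geometrically_bounded_shift _ (fun m => D m i j)).
  rewrite mxE; under eq_bigr do rewrite mxE.
  rewrite -egf_lincomb//; congr egf.
  by apply/funext => m; rewrite DSS mxE.
Qed.

End FundamentalMatrices.

(** * Integration and regularity along curves *)

Lemma is_derive1_continuous {R : realType} {V : normedModType R} (f : R -> V)
    (df : V) (t : R) : is_derive t 1 f df -> {for t, continuous f}.
Proof.
by move=> fdf; apply/differentiable_continuous/derivable1_diffP/ex_derive.
Qed.

Lemma Rintegral_is_derive {R : realType} (f F : R -> R) (a b : R) : a < b ->
  {within `[a, b], continuous f} ->
  (forall t, t \in `[a, b]%R -> is_derive t 1 F (f t)) ->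
  \int[lebesgue_measure]_(t in `[a, b]) f t = F b - F a.
Proof.
move=> ab cf dF; rewrite /Rintegral (@continuous_FTC2 _ _ F)//.
  split.
  - by move=> t /subset_itv_oo_cc tab; have Ft := dF t tab; exact: ex_derive.
  - apply: cvg_at_right_filter; apply: is_derive1_continuous; apply: dF.
    by rewrite in_itv/= lexx ltW.
  - apply: cvg_at_left_filter; apply: is_derive1_continuous; apply: dF.
    by rewrite in_itv/= lexx ltW.
by move=> t /subset_itv_oo_cc tab; have Ft := dF t tab; rewrite derive1E derive_val.
Qed.

(** Only used to get continuity of the integrand, so the value of the derivative is left
    unspecified. *)
Lemma is_derive_lagrangian {R : realType} {n} (A : 'M[R]_n)
    {g k : R -> 'cV[R]_n} {dg dk} {t : R} :
  is_derive t 1 g dg -> is_derive t 1 k dk ->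
  exists l, is_derive t 1 (fun s => lagrangian A (g s) (k s)) l.
Proof.
move=> dgt dkt.
have dA := is_derive_mulmxr A dgt.
have d1 := is_derive_dot dkt dkt.
have d2 := is_derive_dot dgt dA.
eexists; exact: (is_deriveB (is_deriveZ 2^-1 d1) (is_deriveZ 2^-1 d2)).
Qed.

(** Smoothness holds on an open neighbourhood of [E], so two-sided derivatives exist even at the
    endpoints of an interval. *)
Lemma smooth_near_differentiable {R : realType} {W : normedModType R}
    {E : set R} {g : R -> W} {t} :
  smooth_near E g -> E t -> differentiable g t /\ differentiable (derive1 g) t.
Proof.
move=> [U [_ EU gk]] /EU Ut; have [dg d2g] := gk 2%N; split; first exact: dg.
have [d2gU _] := d2g 1.
rewrite (_ : derive1 g = (fun x => 'D_1 g x)); first exact: d2gU.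
by apply/funext => x; rewrite derive1E.
Qed.

(** * Extremals of the action and their minimality *)

Section EulerLagrange.
Context {R : realType} {n : nat} (A : 'M[R]_n).

(** The second-order equation as a first-order system: [k] is the velocity of [h]. *)
Definition euler_lagrange (h k : R -> 'cV[R]_n) :=
  (forall t : R, is_derive t 1 h (k t)) /\
  (forall t : R, is_derive t 1 k (- A *m h t)).

(* Directional derivatives of a solution are again solutions of the equation,
   whence smoothness of every order. *)
Lemma euler_lagrange_Ck k U h hd : euler_lagrange h hd -> Ck_on k U h.
Proof.
elim: k U h hd => [|k IH] U h hd [dh dhd] /=.
  by move=> t _; apply: is_derive1_continuous.
have diffh t : differentiable h t by apply/derivable1_diffP/ex_derive.
split=> // v.
have -> : (fun x => 'D_v h x) = fun x => v *: hd x.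
  apply/funext => x; rewrite deriveE// -[v in LHS]mulr1.
  rewrite (_ : v * 1 = v *: (1 : R)) // linearZ /= -deriveE//.
  by rewrite derive_val.
apply: (IH _ _ (fun x => v *: (- A *m h x))); split=> t.
  exact: is_deriveZ.
rewrite -scalemxAr; apply: is_deriveZ; exact: is_derive_mulmxr.
Qed.

Hypothesis A_sym : A^T = A.

Lemma dot_sym (u v : 'cV[R]_n) : dot (A *m u) v = dot u (A *m v).
Proof. by rewrite dot_mulmxr A_sym. Qed.

(** In the derivative the terms h'.k' cancel, and what remains, h.Ak - Ah.k, vanishes by symmetry of
    [A]. *)
Lemma wronskian_constant {h hd k kd} t :
  euler_lagrange h hd -> euler_lagrange k kd ->
  dot (hd t) (k t) - dot (h t) (kd t) = dot (hd 0) (k 0) - dot (h 0) (kd 0).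
Proof.
move=> [dh dhd] [dk dkd].
apply: (@is_derive_0_is_cst _ (fun s => dot (hd s) (k s) - dot (h s) (kd s))).
move=> s; apply: is_derive_eq.
  apply: is_deriveB; exact: is_derive_dot.
rewrite !mulNmx dotNl dotNr dot_sym; ring.
Qed.

Hypothesis A_le0 : negsemidef A.

(* Weierstrass' argument: since L is convex, L(g, g') dominates its linearization
   along an extremal h, which is the total derivative of h'.g - h.h'/2. *)
Lemma lagrangian_ge (g k h kh : 'cV[R]_n) :
  dot kh k - dot (A *m h) g - 2^-1 * (dot kh kh - dot h (A *m h)) <=
  lagrangian A g k.
Proof.
rewrite /lagrangian -subr_ge0.
(* The difference of the two sides is exactly |k - kh|^2/2 - (g - h).A(g - h)/2. *)
have := dotvv_ge0 (k - kh); have := A_le0 (g - h).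
rewrite mulmxBr !dotDr !dotDl !dotNr !dotNl.
rewrite (dotC kh k) dot_sym (dotC g (A *m h)) dot_sym; lra.
Qed.

Section Action.
Context {T : R} (T_gt0 : 0 < T) {h k : R -> 'cV[R]_n}.
Hypothesis h_EL : euler_lagrange h k.

Let Phi (g : R -> 'cV[R]_n) t := dot (k t) (g t) - 2^-1 * dot (h t) (k t).

(** Along an extremal (h.h')' = |h'|^2 - h.Ah, which is twice the Lagrangian. *)
Lemma action_euler_lagrange :
  action A T h = 2^-1 * (dot (h T) (k T) - dot (h 0) (k 0)).
Proof.
have [dh dk] := h_EL.
have -> : action A T h =
    \int[lebesgue_measure]_(t in `[0, T]) lagrangian A (h t) (k t).
  by apply: eq_Rintegral => t _; rewrite derive1E derive_val.
rewrite mulrBr.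
apply: (@Rintegral_is_derive _ _ (fun t => 2^-1 * dot (h t) (k t))) => //.
- apply: continuous_in_subspaceT => t _.
  have [l dl] := is_derive_lagrangian A (dh t) (dk t).
  exact: is_derive1_continuous dl.
- move=> t _; apply: (@is_derive_eq _ _ _ (2^-1 *: (fun s => dot (h s) (k s)))).
    by apply: is_deriveZ; exact: is_derive_dot.
  rewrite mulNmx dotNr /lagrangian [LHS]mulrDr mulrN //.
Qed.

(** The pointwise bound [lagrangian_ge] is integrated over [0, T]; its left side [f] is the
    derivative of [Phi g], so only boundary terms survive. *)
Lemma action_ge g : smooth_near `[0, T] g ->
  dot (k T) (g T) - dot (k 0) (g 0) - 2^-1 * (dot (h T) (k T) - dot (h 0) (k 0))
  <= action A T g.
Proof.
move=> sg; have [dh dk] := h_EL.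
have dg (t : R) : t \in `[0, T]%R -> is_derive t 1 g (derive1 g t).
  move=> t0T; have [+ _] := smooth_near_differentiable sg t0T.
  by move=> /derivable1_diffP/derivableP; rewrite derive1E.
have d2g (t : R) : t \in `[0, T]%R -> is_derive t 1 (derive1 g) ('D_1 (derive1 g) t).
  move=> t0T; have [_] := smooth_near_differentiable sg t0T.
  by move=> /derivable1_diffP/derivableP.
pose f t := dot (k t) (derive1 g t) - dot (A *m h t) (g t) -
            2^-1 * (dot (k t) (k t) - dot (h t) (A *m h t)).
have dPhi (t : R) : t \in `[0, T]%R -> is_derive t 1 (Phi g) (f t).
  move=> /dg dgt; apply: is_derive_eq.
    apply: is_deriveB; first exact: is_derive_dot.
    by apply: is_deriveZ; exact: is_derive_dot.
  rewrite /f !mulNmx dotNl dotNr /GRing.scale/=; ring.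
have cf : {within `[0, T], continuous f}.
  apply: continuous_in_subspaceT => t; rewrite inE => t0T.
  have dAh := is_derive_mulmxr A (dh t).
  have d1 := is_derive_dot (dk t) (d2g t t0T).
  have d2 := is_derive_dot dAh (dg t t0T).
  have d3 := is_derive_dot (dk t) (dk t).
  have d4 := is_derive_dot (dh t) dAh.
  have df := is_deriveB (is_deriveB d1 d2) (is_deriveZ 2^-1 (is_deriveB d3 d4)).
  exact: is_derive1_continuous df.
have cL : {within `[0, T], continuous fun t => lagrangian A (g t) (derive1 g t)}.
  apply: continuous_in_subspaceT => t; rewrite inE => t0T.
  have [l] := is_derive_lagrangian A (dg t t0T) (d2g t t0T).
  exact: is_derive1_continuous.
rewrite [leLHS](_ : _ = Phi g T - Phi g 0); last by rewrite /Phi; ring.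
rewrite -(@Rintegral_is_derive _ f _ _ _ T_gt0 cf dPhi); apply: le_Rintegral => //.
- by apply: continuous_compact_integrable => //; exact: segment_compact.
- by apply: continuous_compact_integrable => //; exact: segment_compact.
- by move=> t _; exact: lagrangian_ge.
Qed.

Lemma lagrangian_cost_euler_lagrange :
  lagrangian_cost A T (h 0) (h T) =
  2^-1 * (dot (h T) (k T) - dot (h 0) (k 0)).
Proof.
(* The bound of [action_ge] sees [g] only through its endpoints; when these are those of [h], it
   equals the action of [h]. *)
have lb : lbound [set action A T g | g in admissible T (h 0) (h T)]
    (2^-1 * (dot (h T) (k T) - dot (h 0) (k 0))).
  move=> _ [g [sg g0 gT] <-]; apply: le_trans (action_ge g sg).
  rewrite g0 gT (dotC (k T)) (dotC (k 0)); lra.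
have hin : [set action A T g | g in admissible T (h 0) (h T)]
    (2^-1 * (dot (h T) (k T) - dot (h 0) (k 0))).
  exists h; last exact: action_euler_lagrange.
  split=> //; exists setT; split => //; first exact: openT.
  by move=> j; exact: euler_lagrange_Ck h_EL.
apply/eqP; rewrite eq_le /lagrangian_cost ge_inf ?lb_le_inf//.
- by eexists; exact: hin.
- by eexists; exact: lb.
Qed.

End Action.

End EulerLagrange.

(** * The cost is a quadratic form in (x, y) *)

Lemma unitmx_cV {R : fieldType} {n} (M : 'M[R]_n) :
  (forall v : 'cV[R]_n, M *m v = 0 -> v = 0) -> M \in unitmx.
Proof.
(* [det0P] yields a row vector in the left kernel, hence the passage to the transpose. *)
move=> M0; rewrite -unitmx_tr unitmxE unitfE; apply/negP => /det0P[v v0 vM].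
move/eqP: v0; apply; apply: trmx_inj; rewrite trmx0; apply: M0.
by rewrite -[M]trmxK -trmx_mul vM trmx0.
Qed.

Section QuadraticCost.
Context {R : realType} {n : nat} (A : 'M[R]_n).
Hypotheses (A_sym : A^T = A) (A_le0 : negsemidef A).

(* Energy conservation gives (h.h')' = |h'|^2 - h.Ah >= |h'(0)|^2, so h.h'
   cannot vanish at both ends. *)
Lemma euler_lagrange_dirichlet0 {h k : R -> 'cV[R]_n} {T : R} : 0 < T ->
  euler_lagrange A h k -> h 0 = 0 -> h T = 0 -> k 0 = 0.
Proof.
move=> T0 [dh dk] h0 hT.
have energy (t : R) :
    dot (k t) (k t) + dot (h t) (A *m h t) = dot (k 0) (k 0).
  transitivity (dot (k 0) (k 0) + dot (h 0) (A *m h 0)); last first.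
    by rewrite h0 dot0l addr0.
  apply: (@is_derive_0_is_cst _ (fun s => dot (k s) (k s) + dot (h s) (A *m h s))).
  move=> s; have dAh := is_derive_mulmxr A (dh s).
  apply: is_derive_eq.
    by apply: is_deriveD; exact: is_derive_dot.
  rewrite !mulNmx dotNl dotNr -(dot_sym _ A_sym (h s)) (dotC (k s)) //; ring.
have dhk (t : R) : is_derive t 1 (fun s => dot (h s) (k s))
    (dot (k t) (k t) - dot (h t) (A *m h t)).
  apply: is_derive_eq; first exact: is_derive_dot.
  by rewrite mulNmx dotNr.
(* As h.h' vanishes at 0 and T, some c has |h'(c)|^2 = h(c).Ah(c); energy then gives |h'(0)|^2 = 2
   h(c).Ah(c) <= 0. *)
have [|c _] := MVT T0 (fun t _ => dhk t).
  by apply: continuous_subspaceT => t; exact: is_derive1_continuous (dhk t).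
rewrite h0 hT !dot0l !subr0 => /esym/eqP; rewrite mulf_eq0 (gt_eqF T0) orbF.
move=> /eqP cE; apply: dotvv_eq0; apply/eqP.
rewrite eq_le dotvv_ge0 andbT; have := energy c; have := A_le0 (h c).
move: cE; lra.
Qed.

Lemma lagrangian_cost_quadratic (T : R) : 0 < T ->
  exists P Q K : 'M[R]_n, Q \in unitmx /\
    forall x y, lagrangian_cost A T x y =
      dot x (P *m x) + dot x (Q *m y) + dot y (K *m y).
Proof.
move=> T0; have [S [C [S0 C0 dS dC]]] := cosh_sinh_mx (- A).
pose h (z w : 'cV[R]_n) t := C t *m z + S t *m w.
pose k (z w : 'cV[R]_n) t := (- A *m S t) *m z + C t *m w.
have EL z w : euler_lagrange A (h z w) (k z w).
  split=> t.
    by apply: is_deriveD; exact: is_derive_mulmxl.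
  rewrite (_ : _ *m _ = - A *m C t *m z + - A *m S t *m w).
    apply: is_deriveD; apply: is_derive_mulmxl => //; exact: is_derive_mulmxr.
  by rewrite mulmxDr !mulmxA.
have h0 z w : h z w 0 = z by rewrite /h C0 S0 mul1mx mul0mx addr0.
have k0 z w : k z w 0 = w by rewrite /k C0 S0 mulmx0 mul1mx mul0mx add0r.
(* S(T) v is the position at T of the extremal leaving 0 with velocity v, so a kernel vector gives a
   Dirichlet solution. *)
have ST : S T \in unitmx.
  apply: unitmx_cV => v Sv; rewrite -[LHS](k0 0 v).
  apply: (euler_lagrange_dirichlet0 T0 (EL 0 v)) => //.
  by rewrite /h mulmx0 add0r.
pose V := invmx (S T).
(* V(y - C(T) x) is the initial velocity of the extremal from x to y. *)
have hT x y : h x (V *m (y - C T *m x)) T = y.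
  by rewrite /h mulKVmx// addrC subrK.
exists (2^-1 *: (V *m C T)), (- V), (2^-1 *: (C T *m V)).
split; first by rewrite -scaleN1r unitmxZ ?unitrN1 ?unitmx_inv.
move=> x y.
have := lagrangian_cost_euler_lagrange _ A_sym A_le0 T0
  (EL x (V *m (y - C T *m x))).
rewrite h0 hT k0 => ->.
(* The extremal from x to 0 is paired with the one from 0 to y. Equating the Wronskians at T and 0
   shows that the x-part of h'(T), dotted with y, is - x.V y; this replaces the mixed term of
   y.h'(T). *)
have := wronskian_constant _ A_sym T (EL x (V *m (0 - C T *m x)))
  (EL 0 (V *m (y - C T *m 0))).
rewrite !hT !h0 !k0 !dot0l subr0 dot0r sub0r.
rewrite /k mulmx0 subr0 sub0r !mulmxN !mulmxBr !dotDl !dotNl !dotDr !dotNr.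
rewrite -!scalemxAl !dotZr !mulmxA.
rewrite !(mulNmx, dotNl, dotNr) !(dotC y).
lra.
Qed.

End QuadraticCost.

(** * Stability of the class C^k, and smoothness of quadratic expressions *)

Section SmoothFunctions.
Context {R : realType} {V : normedModType R}.
Implicit Types (k : nat) (f g : V -> R).

(** Needed for the product rule, where the undifferentiated factor enters one order lower. *)
Lemma Ck_onT_S {k f} : Ck_on k.+1 setT f -> Ck_on k setT f.
Proof.
elim: k f => [|k IH] f [df d2f] /=.
  by move=> x _; apply: differentiable_continuous; exact: df.
by split=> // v; exact: IH.
Qed.

Lemma Ck_onT_cst {k} (a : R) : Ck_on k setT (fun _ : V => a).
Proof.
elim: k a => [|k IH] a /=; first by move=> x _; exact: cvg_cst.
split=> [x _|v]; first exact: differentiable_cst.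
have -> : (fun x => 'D_v (fun _ : V => a) x) = fun=> 0; last exact: IH.
by apply/funext => x; exact: derive_cst.
Qed.

Lemma Ck_onT_linear {k} f : linear f -> continuous f -> Ck_on k setT f.
Proof.
suff lin (l : {linear V -> R}) : continuous l -> Ck_on k setT l.
  by move=> linf; exact: (lin (HB.pack f (GRing.isLinear.Build _ _ _ _ _ linf))).
case: k => [|k] cl /=; first by move=> x _; exact: cl.
split=> [x _|v]; first exact: linear_differentiable.
have -> : (fun x => 'D_v l x) = fun=> l v; last exact: Ck_onT_cst.
apply/funext => x; rewrite deriveE; last exact: linear_differentiable.
by rewrite diff_lin.
Qed.

Lemma Ck_onTD {k f g} : Ck_on k setT f -> Ck_on k setT g ->
  Ck_on k setT (fun x => f x + g x).
Proof.
elim: k f g => [|k IH] f g /=.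
  by move=> cf cg x _; apply: cvgD; [exact: cf|exact: cg].
move=> [df d2f] [dg d2g]; split=> [x _|v].
  by apply: differentiableD; [exact: df|exact: dg].
rewrite (_ : (fun _ => _) = fun x => 'D_v f x + 'D_v g x); first exact: IH.
apply/funext => x.
by rewrite -deriveD//; apply: diff_derivable; [exact: df|exact: dg].
Qed.

Lemma Ck_onTM {k f g} : Ck_on k setT f -> Ck_on k setT g ->
  Ck_on k setT (fun x => f x * g x).
Proof.
elim: k f g => [|k IH] f g.
  by move=> cf cg x _; apply: cvgM; [exact: cf|exact: cg].
move=> fS gS; have [fk gk] := (Ck_onT_S fS, Ck_onT_S gS).
move: fS gS => [df d2f] [dg d2g]; split=> [x _|v].
  by apply: differentiableM; [exact: df|exact: dg].
rewrite (_ : (fun _ => _) = fun x => f x * 'D_v g x + g x * 'D_v f x).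
  by apply: Ck_onTD; [exact: (IH _ _ fk (d2g v))|exact: (IH _ _ gk (d2f v))].
apply/funext => x.
by rewrite -deriveM//; apply: diff_derivable; [exact: df|exact: dg].
Qed.

Lemma Ck_onT_sum {k} (I : Type) (r : seq I) (f : I -> V -> R) :
  (forall i, Ck_on k setT (f i)) -> Ck_on k setT (fun x => \sum_(i <- r) f i x).
Proof.
move=> fk; elim: r => [|i r IH].
  by under eq_fun do rewrite big_nil; exact: Ck_onT_cst.
by under eq_fun do rewrite big_cons; exact: Ck_onTD.
Qed.

Lemma Ck_onT_mulmx {k n} (M : 'M[R]_n) (u : V -> 'cV[R]_n) :
  (forall i, Ck_on k setT (fun x => u x i 0)) ->
  forall i, Ck_on k setT (fun x => (M *m u x) i 0).
Proof.
move=> uk i; under eq_fun do rewrite mxE.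
by apply: Ck_onT_sum => j; apply: Ck_onTM => //; exact: Ck_onT_cst.
Qed.

Lemma Ck_onT_dot {k n} (u v : V -> 'cV[R]_n) :
  (forall i, Ck_on k setT (fun x => u x i 0)) ->
  (forall i, Ck_on k setT (fun x => v x i 0)) ->
  Ck_on k setT (fun x => dot (u x) (v x)).
Proof.
move=> uk vk; under eq_fun do rewrite dotE.
by apply: Ck_onT_sum => i; exact: Ck_onTM.
Qed.

End SmoothFunctions.

Lemma Ck_onT_coord1 {R : realType} {n k} (i : 'I_n) :
  Ck_on k setT (fun p : 'cV[R]_n * 'cV[R]_n => p.1 i 0).
Proof.
apply: Ck_onT_linear => [a p q|p]; first by rewrite !mxE.
apply: (@continuous_comp _ _ _ fst (fun u : 'cV[R]_n => u i 0)).
  exact: cvg_fst.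
exact: coord_continuous.
Qed.

Lemma Ck_onT_coord2 {R : realType} {n k} (i : 'I_n) :
  Ck_on k setT (fun p : 'cV[R]_n * 'cV[R]_n => p.2 i 0).
Proof.
apply: Ck_onT_linear => [a p q|p]; first by rewrite !mxE.
apply: (@continuous_comp _ _ _ snd (fun u : 'cV[R]_n => u i 0)).
  exact: cvg_snd.
exact: coord_continuous.
Qed.

(** The Riesz representative of a covector, read off on the standard basis. *)
Lemma covector_dot {R : realType} {n} (a : covector R n) u :
  a u = dot u (\col_i a (delta_mx i 0)).
Proof.
rewrite {1}[u]matrix_sum_delta linear_sum dotE; apply: eq_bigr => i _.
by rewrite big_ord1 linearZ mxE.
Qed.

(** * Second derivative of a quadratic function along a curve *)

Section QuadraticCurve.
Context {R : realType} {n : nat}.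
Variables (g : R -> 'cV[R]_n).
Hypothesis g2 : Ck_near 2 [set 0] g.

(** The point is the order of quantifiers: [al] and [be] depend on the curve and [M] alone, so the
    result is affine in [w] and free of [r]. Here [be] is g''(0). *)
Lemma derive1n2_quadratic (M : 'M[R]_n) : exists (al : R) (be : 'cV[R]_n),
  forall (w : 'cV[R]_n) (r : R),
  derive1n 2 (fun t => dot (g t) (M *m g t) + dot (g t) w + r) 0 =
  al + dot be w.
Proof.
have [U [oU U0 [dg]]] := g2.
move=> /(_ 1)[d2g _].
have {U0}U0 : U 0 by exact: U0.
pose g' := derive1 g.
have dgU (t : R) : U t -> is_derive t 1 g (g' t).
  by move=> /dg /derivable1_diffP/derivableP; rewrite /g' derive1E.
have dg'0 : is_derive (0 : R) 1 g' ('D_1 g' 0).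
  apply/derivableP/derivable1_diffP.
  rewrite (_ : g' = (fun x => 'D_1 g x)); first exact: d2g.
  by apply/funext => x; rewrite /g' derive1E.
set g'' := 'D_1 g' 0 in dg'0.
exists (dot g'' (M *m g 0) + dot (g' 0) (M *m g' 0) +
  (dot (g' 0) (M *m g' 0) + dot (g 0) (M *m g''))), g'' => w r.
pose q' (t : R) := dot (g' t) (M *m g t) + dot (g t) (M *m g' t) + dot (g' t) w.
have dq t : U t ->
    is_derive t 1 (fun t => dot (g t) (M *m g t) + dot (g t) w + r) (q' t).
  move=> /dgU gt; have gMt := is_derive_mulmxr M gt.
  have d1 := is_derive_dot gt gMt.
  have d2 := is_derive_dot gt (is_derive_cst w t 1).
  apply: (is_derive_eq (is_deriveD (is_deriveD d1 d2) (is_derive_cst r t 1))).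
  by rewrite dot0r !addr0.
have dq'0 : is_derive (0 : R) 1 q' (dot g'' (M *m g 0) + dot (g' 0) (M *m g' 0) +
    (dot (g' 0) (M *m g' 0) + dot (g 0) (M *m g'')) + dot g'' w).
  have g0 := dgU _ U0.
  have gM0 := is_derive_mulmxr M g0.
  have g'M0 := is_derive_mulmxr M dg'0.
  have d1 := is_derive_dot dg'0 gM0.
  have d2 := is_derive_dot g0 g'M0.
  have d3 := is_derive_dot dg'0 (is_derive_cst w (0 : R) 1).
  apply: (is_derive_eq (is_deriveD (is_deriveD d1 d2) d3)).
  by rewrite dot0r addr0.
(* The first derivative is known only on [U], which suffices for differentiating it at 0. *)
rewrite /derive1n /= derive1E -[RHS](@derive_val _ _ _ _ _ _ _ dq'0).
apply: near_eq_derive; apply: filterS (open_nbhs_nbhs (conj oU U0)) => t Ut.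
by have := dq t Ut => dqt; rewrite derive1E derive_val.
Qed.

End QuadraticCurve.

(** * The conditions on a quadratic cost with invertible mixed part *)

Section QuadraticCostConditions.
Context {R : realType} {n : nat} (c : 'cV[R]_n -> 'cV[R]_n -> R).
Variables (P Q K : 'M[R]_n).
Hypothesis Q_unit : Q \in unitmx.
Hypothesis cE : forall x y, c x y =
  dot x (P *m x) + dot x (Q *m y) + dot y (K *m y).

Lemma quadratic_cost_Ck k :
  Ck_on k setT (fun p : 'cV[R]_n * 'cV[R]_n => c p.1 p.2).
Proof.
under eq_fun do rewrite cE.
have [c1 c2] := (@Ck_onT_coord1 R n k, @Ck_onT_coord2 R n k).
by apply: Ck_onTD; [apply: Ck_onTD|]; apply: Ck_onT_dot => // i;
  exact: Ck_onT_mulmx.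
Qed.

Lemma dx_quadratic x y u :
  dx c x y u = dot u (P *m x) + dot x (P *m u) + dot u (Q *m y).
Proof.
have [dc _] := quadratic_cost_Ck 1.
have dcx : differentiable (fun x' => c x' y) x.
  (* Partial differentiability comes from joint differentiability composed with x' -> (x', y). *)
  have := dc (x, y) I.
  have dp : differentiable (fun x' : 'cV[R]_n => (x', y)) x.
    by apply: differentiable_pair => //; exact: differentiable_cst.
  exact: (differentiable_comp dp).
rewrite /dx lfunE /= -deriveE//.
apply: derive_val.
have did : is_derive x u id u by exact: is_derive_id.
have d1 := is_derive_dot did (is_derive_mulmxr P did).
have d2 := is_derive_dot did (is_derive_cst (Q *m y) x u).
rewrite (_ : (fun _ => _) = fun x' =>
  dot x' (P *m x') + dot x' (Q *m y) + dot y (K *m y)); last first.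
  by apply/funext => x'; rewrite cE.
have d3 := is_deriveD (is_deriveD d1 d2) (is_derive_cst (dot y (K *m y)) x u).
by apply: (is_derive_eq d3); rewrite dot0r !addr0.
Qed.

(** The common core of (A1) and (A2): both [dx] and [dxdy] reduce to u.Qy up to terms free of y. *)
Lemma mulmxQ_inj (y y' : 'cV[R]_n) :
  (forall u, dot u (Q *m y) = dot u (Q *m y')) -> y = y'.
Proof. by move=> /dotl_inj/(congr1 (mulmx (invmx Q))); rewrite !mulKmx. Qed.

Lemma quadratic_condA1 : condA1 c.
Proof.
move=> x y y' yy'; apply: mulmxQ_inj => u.
by have := congr1 (fun a : covector R n => a u) yy'; rewrite !dx_quadratic => /addrI.
Qed.

Lemma dxdy_quadratic x y v u : dxdy c x y v u = dot u (Q *m v).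
Proof.
rewrite /dxdy; apply: derive_val.
rewrite (_ : (fun _ => _) = fun y' =>
  dot u (P *m x) + dot x (P *m u) + dot u (Q *m y')); last first.
  by apply/funext => y'; rewrite dx_quadratic.
have did : is_derive y v id v by exact: is_derive_id.
have d1 := is_derive_dot (is_derive_cst u y v)
  (is_derive_mulmxr Q did).
have d2 := is_deriveD (is_derive_cst (dot u (P *m x) + dot x (P *m u)) y v) d1.
by apply: (is_derive_eq d2); rewrite dot0l !add0r.
Qed.

Lemma quadratic_condA2 : condA2 c.
Proof.
move=> x y v v' vv'; apply: mulmxQ_inj => u.
by rewrite -!(dxdy_quadratic x y) vv'.
Qed.

(** Invertibility of [Q] makes y -> dx c x y onto all covectors, so [cexp] never takes the default
    value of [get], and a + s a1 stays in the domain for every s. *)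
Lemma dx_cexp x a : dx c x (cexp c x a) = - a.
Proof.
suff : exists y, dx c x y = - a by move=> ex; exact: (getPex ex).
pose b : covector R n := - a - dx c x 0.
(* Solves Qy = b, where [b] is what remains of - a once the part of [dx] free of y is removed. *)
exists (invmx Q *m \col_i b (delta_mx i 0)).
apply/lfunP => u; rewrite dx_quadratic mulKVmx// -covector_dot /b.
rewrite add_lfunE !opp_lfunE dx_quadratic mulmx0 dot0r addr0; ring.
Qed.

Lemma quadratic_cross_curvature_zero : cross_curvature_zero c.
Proof.
move=> x u a a1 g _ [g2 _ _]; rewrite /cross_curvature.
have [al [be quad]] := derive1n2_quadratic _ g2 P.
pose col (b : covector R n) := \col_i b (delta_mx i 0).
(* By [dx_cexp], w0 - s col(a1) is Qy for y = exp^c(x, a + s a1). *)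
pose w0 := - (col a + P *m x + P^T *m x).
pose F s := al + dot be w0 - s * dot be (col a1).
have -> : (fun s => derive1n 2 (fun t => c (g t) (cexp c x (a + s *: a1))) 0) =
    F.
  apply/funext => s; set y := cexp _ _ _.
  (* The term y.Ky depends on s but not on t, so it plays the role of [r] and disappears. *)
  have -> : (fun t => c (g t) y) = (fun t => dot (g t) (P *m g t) +
      dot (g t) (w0 - s *: col a1) + dot y (K *m y)).
    apply/funext => t; rewrite cE; congr (_ + _ + _).
    have := congr1 (fun b : covector R n => b (g t)) (dx_cexp x (a + s *: a1)).
    rewrite dx_quadratic opp_lfunE add_lfunE scale_lfunE !(covector_dot _ (g t)).
    rewrite -/y -/(col a) -/(col a1) (dot_mulmxr x) (dotC _ (g t)).
    rewrite /w0 !(dotDr, dotNr, dotZr) /GRing.scale/=; lra.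
  by rewrite /F quad dotDr -scaleNr dotZr mulNr addrA.
have dF (s : R) : is_derive s 1 F (- dot be (col a1)).
  apply: is_derive_eq; rewrite /GRing.scale/=; ring.
have dFE : derive1 F = cst (- dot be (col a1)).
  by apply/funext => s; rewrite derive1E derive_val.
by rewrite derive1Sn derive1n1 dFE derive1_cst mulr0.
Qed.

End QuadraticCostConditions.

Theorem theorem4p1 (R : realType) (n : nat) (n_ge1 : (1 <= n)%N)
    (A : 'M[R]_n) (A_sym : A^T = A) (A_le0 : negsemidef A)
    (T : R) (T_gt0 : 0 < T) :
  let c := lagrangian_cost A T in
  [/\ condA0 c, condA1 c & condA2 c] /\
  cross_curvature_zero c /\
  condB3w c /\
  condA3w c.
Proof.
move=> c; have [P [Q [K [Q_unit cE]]]] :=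
  lagrangian_cost_quadratic A A_sym A_le0 T T_gt0.
have c0 : cross_curvature_zero c by exact: quadratic_cross_curvature_zero cE.
split; last by split=> //; split=> x u a a1 g Ka xug; rewrite (c0 x u).
split; first exact: quadratic_cost_Ck cE 4.
- exact: quadratic_condA1 cE.
- exact: quadratic_condA2 cE.
Qed.
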